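(* Let $\mathcal{X}=\{x_1,\dots,x_m\}$ be a finite alphabet and let $p\in\mathcal{P}(\mathcal{X})$. For each $n$ let $\nu^n$ be an $n$-type, and suppose $\nu^n\to p$ in total variation. Let $\mathcal{Q}\subseteq\mathcal{P}(\mathcal{X})$ be an open set of sources. Assume the uniform prior on $n$-sources for each $n$. Then $$\lim_{n\to\infty}\frac1n\log\pi(q^n\in\mathcal{Q}\mid\nu^n)=L(\mathcal{Q}\,\|\,p)-L(\mathcal{P}(\mathcal{X})\,\|\,p).$$
   Context: $\mathcal{P}(\mathcal{X})$ is the set of all probability mass functions (pmf's) on $\mathcal{X}$, with the topology induced from $\mathbb{R}^m$; its elements are called sources. $\mathcal{R}_n$ is the set of $n$-rational pmf's, i.e. those of the form $[n_1,\dots,n_m]/n$ with nonnegative integers $n_i$ summing to $n$. Elements of $\mathcal{R}_n$ are called $n$-types (when regarded as empirical measures of sequences of length $n$) or $n$-sources (when regarded as sources, written $q^n$). Uniform prior: $\pi(q^n)=1/N$ for all $q^n\in\mathcal{R}_n$, where $N=\binom{n+m-1}{m-1}=|\mathcal{R}_n|$. Likelihood: $\pi(\nu^n\mid q^n)=\Gamma(\nu^n)\prod_{i=1}^m(q^n_i)^{n\nu^n_i}$, with $\Gamma(\nu^n)=n!/\prod_{i=1}^m n_i!$ for $\nu^n=[n_1,\dots,n_m]/n$ (convention $0^0=1$). The posterior is given by Bayes' theorem: $\pi(q^n\mid\nu^n)=\pi(\nu^n\mid q^n)\pi(q^n)/\sum_{\tilde q\in\mathcal{R}_n}\pi(\nu^n\mid\tilde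 q)\pi(\tilde q)$, and $\pi(q^n\in\mathcal{Q}\mid\nu^n)=\sum_{q^n\in\mathcal{Q}\cap\mathcal{R}_n}\pi(q^n\mid\nu^n)$. For $p,q\in\mathcal{P}(\mathcal{X})$ the $L$-divergence is $L(q\|p)=\sum_{x\in\mathcal{X}}p(x)\log q(x)\in\mathbb{R}\cup\{-\infty\}$ (conventions $\log 0=-\infty$, $0\log 0=0$), and for a set $\mathcal{C}$ of sources $L(\mathcal{C}\|p)=\sup_{q\in\mathcal{C}}L(q\|p)$. *)

(* Defs.v *)
From mathcomp Require Import all_boot all_order all_algebra.
From mathcomp Require Import all_classical all_reals all_analysis.

Set Implicit Arguments.
Unset Strict Implicit.
Unset Printing Implicit Defensive.

Import Order.TTheory GRing.Theory Num.Theory.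
Import numFieldNormedType.Exports.

Local Open Scope classical_set_scope.
Local Open Scope ring_scope.

Section Sources.
Variables (R : realType) (m : nat).
Implicit Types (p q nu : 'rV[R]_m) (A C Q : set 'rV[R]_m).

(* The alphabet is 'I_m; a pmf is the row vector of its values. *)
Definition pmfs : set 'rV[R]_m :=
  [set p | (forall i, 0 <= p 0 i) /\ \sum_(i < m) p 0 i = 1].

(* Openness is relative to [pmfs], with the topology induced from R^m. *)
Definition open_sources Q : Prop :=
  exists2 U : set 'rV[R]_m, open U & Q = pmfs `&` U.

(* The n-rational pmf's; empty for n = 0, since 0 is not a pmf for x / 0 = 0. *)
Definition rational_pmfs (n : nat) : set 'rV[R]_m :=
  [set q | pmfs q /\
    exists2 k : 'I_m -> nat,
      (\sum_(i < m) k i)%N = n & forall i, q 0 i = (k i)%:R / n%:R].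

Definition tv_dist p q : R := 2^-1 * \sum_(i < m) `|p 0 i - q 0 i|.

(* The truncation is exact when [nu] is an n-type: n * nu_i is then the number
   of occurrences of the i-th letter. *)
Definition type_count (n : nat) nu (i : 'I_m) : nat :=
  Num.truncn (n%:R * nu 0 i).

Definition multinomial_coef (n : nat) nu : R :=
  n`!%:R / \prod_(i < m) (type_count n nu i)`!%:R.

Definition likelihood (n : nat) nu q : R :=
  multinomial_coef n nu * \prod_(i < m) q 0 i ^+ type_count n nu i.

Definition uniform_prior (n : nat) q : R := ('C(n + m - 1, m - 1))%:R^-1.

(* The summations below are over subsets of the finite set [rational_pmfs n]. *)
Definition posterior (n : nat) (prior : 'rV[R]_m -> R) nu q : R :=
  likelihood n nu q * prior q /
  \sum_(q' \in rational_pmfs n) (likelihood n nu q' * prior q').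

Definition posterior_prob (n : nat) (prior : 'rV[R]_m -> R) nu Q : R :=
  \sum_(q \in Q `&` rational_pmfs n) posterior n prior nu q.

(* [lne 0 = -oo] and [0 * -oo = 0] are the usual conventions. *)
Definition Ldiv q p : \bar R := (\sum_(i < m) (p 0 i)%:E * lne (q 0 i)%:E)%E.

Definition Ldiv_set C p : \bar R := ereal_sup [set Ldiv q p | q in C].

End Sources.

Arguments pmfs : clear implicits.
Arguments rational_pmfs : clear implicits.
Arguments uniform_prior : clear implicits.

(* Main.v *)
Require Import Defs.
From mathcomp Require Import all_boot all_order all_algebra.
From mathcomp Require Import all_classical all_reals all_analysis.
From mathcomp Require Import lra.
Set Implicit Arguments.
Unset Strict Implicit.
Unset Printing Implicit Defensive.

Import Order.TTheory GRing.Theory Num.Theory.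
Import numFieldNormedType.Exports.
Local Open Scope classical_set_scope.
Local Open Scope ring_scope.

(** With a uniform prior the prior and the multinomial coefficient cancel in
Bayes' formula, so the posterior probability of [Q] is the quotient of
[mass n nu Q], the sum over the n-sources q in [Q] of the probability that q
gives to one fixed sequence of type nu, by the same sum over all n-sources. It
therefore suffices to show, for every open set of sources [Q], that
log (mass n nu^n Q) / n tends to L(Q || p) ([mass_cvg]): the theorem is the
difference of the instances [Q] and P(X), the latter being open in itself.

Each summand of the mass is exp (n L(q || nu^n)), and there are at most
(n+1)^m of them, a subexponential number, so only the largest summand counts.

- Upper bound ([mass_le]). Since log q_i <= 0, letters with p_i = 0 may be
  dropped from L(q || nu^n), and for the others nu^n_i >= (1 - d) p_i for large
  n. Hence L(q || nu^n) <= (1 - d) L(q || p), uniformly in q.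

- Lower bound ([mass_ge]). Given q in [Q] with L(q || p) > a, mixing q with a
  little of the uniform source stays in the open set [Q] and makes all
  coordinates positive without losing the inequality ([positive_source]). Near
  a positive source L is jointly continuous, so n-sources q^n converging to it
  ([rational_pmfs_dense]) eventually lie in [Q] and satisfy
  L(q^n || nu^n) > a; a single such summand is enough.

The same mixing shows that L(Q || p) is finite for nonempty [Q]; for empty [Q]
both sides are -oo. *)

(** * Convergence of row vectors and growth of the number of types *)
Section Convergence.
Context {R : realType} {m : nat} {T : Type} {F : set_system T} {FF : Filter F}.

Lemma cvg_row_coord (f : T -> 'rV[R]_m) (q : 'rV[R]_m) :
  (forall i, f x 0 i @[x --> F] --> q 0 i) -> f x @[x --> F] --> q.
Proof.
move=> fq A [P Pnbhs PA].
have : \forall x \near F, forall i, P 0 i (f x 0 i).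
  by apply: filter_forall => i; exact: fq.
rewrite nbhs_simpl /=; apply: filterS => x Px; apply: PA => i j.
by rewrite (ord1 i); exact: Px.
Qed.

Lemma cvg_sum_ord (P : pred 'I_m) (f : T -> 'I_m -> R) (l : 'I_m -> R) :
  (forall i, f x i @[x --> F] --> l i) ->
  \sum_(i < m | P i) f x i @[x --> F] --> \sum_(i < m | P i) l i.
Proof. by move=> fl; apply: cvg_big => //; exact: add_continuous. Qed.

End Convergence.

Lemma tv_cvg_coord (R : realType) (m : nat) (nu : nat -> 'rV[R]_m)
    (p : 'rV[R]_m) (i : 'I_m) :
  (fun n => tv_dist (nu n) p) @ \oo --> (0 : R) ->
  nu n 0 i @[n --> \oo] --> p 0 i.
Proof.
move=> /cvgr0Pnorm_lt tv0; apply/cvgrPdist_lt => e e0.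
have := tv0 (2^-1 * e) ltac:(lra); apply: filterS => n.
rewrite /tv_dist normrM ger0_norm ?invr_ge0// ltr_pM2l ?invr_gt0//.
apply: le_lt_trans; rewrite ger0_norm ?sumr_ge0// distrC.
by rewrite (bigD1 i)//= lerDl sumr_ge0.
Qed.

(** The Taylor term of degree [m.+1] of the exponential already beats the
polynomial. *)
Lemma poly_le_exp (R : realType) (m : nat) (e : R) : 0 < e ->
  \forall n \near \oo, (n.+1 ^ m)%:R <= expR (n%:R * e).
Proof.
move=> e0; near=> n.
have n0 : (0 < n)%N by near: n; exact: nbhs_infty_gt.
have := expR_ge1Dxn m (mulr_ge0 (ler0n R n) (ltW e0)).
apply: le_trans; apply: (@le_trans _ _ ((2 * n) ^ m)%:R).
  rewrite !natrX lerXn2r ?nnegrE ?ler0n// ler_nat.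
  by rewrite mul2n -addnn -addn1 leq_add2l.
apply: (@le_trans _ _ ((n%:R * e) ^+ m.+1 / (m.+1)`!%:R)); last first.
  by rewrite lerDr.
rewrite ler_pdivlMr ?ltr0n ?fact_gt0// natrX natrM !exprMn [n%:R ^+ m.+1]exprS.
have large : 2 ^+ m * (m.+1)`!%:R / e ^+ m.+1 <= n%:R.
  by near: n; exact: nbhs_infty_ger.
rewrite ler_pdivrMr ?exprn_gt0// in large.
rewrite [leLHS]mulrAC [leRHS]mulrAC; by rewrite ler_wpM2r ?exprn_ge0.
Unshelve. all: by end_near. Qed.

(** * Real-valued L-divergence *)
Section Divergence.
Variables (R : realType) (m : nat).
Implicit Types p q nu : 'rV[R]_m.

Definition Ldivr q p : R := \sum_(i < m) p 0 i * ln (q 0 i).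

Lemma LdivE q p :
  (forall i, p 0 i != 0 -> 0 < q 0 i) -> Ldiv q p = (Ldivr q p)%:E.
Proof.
move=> q_gt0; rewrite /Ldiv /Ldivr -sumEFin; apply: eq_bigr => i _.
have [->|p0] := eqVneq (p 0 i) 0; first by rewrite mul0e mul0r.
by rewrite lne_EFin ?q_gt0.
Qed.

Lemma Ldiv_gtNy_gt0 q p : pmfs R m p -> (-oo < Ldiv q p)%E ->
  forall i, p 0 i != 0 -> 0 < q 0 i.
Proof.
move=> [p0 _] L i pi0; rewrite ltNge; apply/negP => qi0.
move: L; rewrite ltNye => /negP; apply; rewrite /Ldiv esum_eqNy.
apply/existsP; exists i => /=.
by rewrite qi0 gt0_muleNy ?eqxx // lte_fin lt_neqAle eq_sym pi0 p0.
Qed.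

End Divergence.

(** * Sums over n-types and density of the n-types *)
Section Types.
Variables (R : realType) (m : nat).
Implicit Types (p q nu : 'rV[R]_m) (A : set 'rV[R]_m) (n : nat).

Lemma pmf_le1 q i : pmfs R m q -> q 0 i <= 1.
Proof. by move=> [q0 <-]; rewrite (bigD1 i)//= lerDl sumr_ge0. Qed.

Lemma pmf_dim_gt0 q : pmfs R m q -> (0 < m)%N.
Proof.
move=> [_ q1]; rewrite lt0n; apply/eqP => m0.
have := oner_neq0 R; rewrite -q1 big1 ?eqxx// => i _.
by have := ltn_ord i; rewrite {2}m0.
Qed.

Lemma type_countE n nu i : rational_pmfs R m n nu -> (0 < n)%N ->
  (type_count n nu i)%:R = n%:R * nu 0 i.
Proof.
move=> [_ [k _ nuk]] n0; rewrite /type_count nuk mulrCA divff ?mulr1 ?natrK//.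
by rewrite pnatr_eq0 -lt0n.
Qed.

(** A numerator of an n-type is at most [n], so the functions from letters to
{0, ..., n} enumerate the n-types together with vectors that are not pmf's; this
crude count is polynomial in [n]. *)
Lemma rational_pmfs_seq n : exists2 s : seq 'rV[R]_m,
  (size s = n.+1 ^ m)%N & rational_pmfs R m n `<=` [set` s].
Proof.
exists [seq \row_i ((k i : nat)%:R / n%:R) | k : {ffun 'I_m -> 'I_n.+1}].
  by rewrite size_image card_ffun !card_ord.
move=> q [_ [k kn qk]] /=; apply/mapP.
exists [ffun i => inord (k i)]; first by rewrite mem_enum.
apply/rowP => i.
rewrite mxE qk ffunE inordK// ltnS -kn (bigD1 i)//=; exact: leq_addr.
Qed.

Lemma finite_rational_pmfs n A : finite_set (A `&` rational_pmfs R m n).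
Proof.
have [s _ ss] := rational_pmfs_seq n.
by apply: sub_finite_set (finite_seq s) => q [_ /ss].
Qed.

Lemma fsum_rational_le n A (f : 'rV[R]_m -> R) (M : R) : 0 <= M ->
  (forall q, A q -> rational_pmfs R m n q -> f q <= M) ->
  \sum_(q \in A `&` rational_pmfs R m n) f q <= (n.+1 ^ m)%:R * M.
Proof.
move=> M0 fM; have fin := finite_rational_pmfs n A.
rewrite fsbig_finite//=; apply: (@le_trans _ _
  (\sum_(q <- finmap.enum_fset (fset_set (A `&` rational_pmfs R m n))) M)).
  rewrite big_seq [leRHS]big_seq; apply: ler_sum => q.
  by rewrite in_fset_set// inE => -[Aq qn]; exact: fM.
rewrite big_const_seq count_predT iter_addr_0 -[leLHS]mulr_natl ler_wpM2r//.
have [s <- ss] := rational_pmfs_seq n.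
rewrite ler_nat; apply: uniq_leq_size; first exact: finmap.fset_uniq.
by move=> q; rewrite in_fset_set// inE => -[_ /ss].
Qed.

Lemma fsum_rational_ge n A (f : 'rV[R]_m -> R) q :
  (forall q', rational_pmfs R m n q' -> 0 <= f q') ->
  A q -> rational_pmfs R m n q ->
  f q <= \sum_(q' \in A `&` rational_pmfs R m n) f q'.
Proof.
move=> f0 Aq qn; have fin := finite_rational_pmfs n A.
have qin : q \in finmap.enum_fset (fset_set (A `&` rational_pmfs R m n)).
  by rewrite in_fset_set// inE.
rewrite fsbig_finite//= (bigD1_seq q)//=; last exact: finmap.fset_uniq.
rewrite lerDl big_seq_cond; apply: sumr_ge0 => q' /andP[+ _].
by rewrite in_fset_set// inE => -[_]; exact: f0.
Qed.

(** Round every n * q_j down, except at one letter [i0], which gets the rest. *)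
Lemma rational_pmfs_dense q : pmfs R m q ->
  exists2 qn : nat -> 'rV[R]_m,
    forall n, (0 < n)%N -> rational_pmfs R m n (qn n) &
    forall i, qn n 0 i @[n --> \oo] --> q 0 i.
Proof.
move=> qP; have [q0 q1] := qP; pose i0 := Ordinal (pmf_dim_gt0 qP).
pose t n j := Num.truncn (n%:R * q 0 j).
pose r n j : R := (t n j)%:R / n%:R.
have tle n j : (t n j)%:R <= n%:R * q 0 j by rewrite truncn_le mulr_ge0.
have r_cvg j : r n j @[n --> \oo] --> q 0 j.
  apply/cvgrPdist_le => e e0; near=> n.
  have n0 : (0 < n)%N by near: n; exact: nbhs_infty_gt.
  have n0' : (0 : R) < n%:R by rewrite ltr0n.
  have -> : q 0 j - r n j = (n%:R * q 0 j - (t n j)%:R) / n%:R.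
    by rewrite mulrBl mulrAC divff ?gt_eqF// mul1r.
  rewrite ger0_norm ?divr_ge0 ?subr_ge0 ?tle// ler_pdivrMr// lerBlDl.
  apply: (@le_trans _ _ ((t n j)%:R + 1)).
    by rewrite natr1 ltW// truncnS_gt.
  rewrite lerD2l mulrC -ler_pdivrMr// mul1r.
  by near: n; exact: nbhs_infty_ger.
exists (fun n => \row_i
  if i == i0 then 1 - \sum_(j < m | j != i0) r n j else r n i).
- move=> n n0; have n0' : (0 : R) < n%:R by rewrite ltr0n.
  have sum_le : (\sum_(j < m | j != i0) t n j <= n)%N.
    rewrite -(ler_nat R) natr_sum.
    apply: (@le_trans _ _ (\sum_(j < m) n%:R * q 0 j)).
      rewrite [leRHS](bigD1 i0)//= -[leLHS]add0r lerD ?mulr_ge0//.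
      exact: ler_sum.
    by rewrite -mulr_sumr q1 mulr1.
  pose k i := if i == i0 then (n - \sum_(j < m | j != i0) t n j)%N else t n i.
  have kE i : (if i == i0 then 1 - \sum_(j < m | j != i0) r n j else r n i) =
      (k i)%:R / n%:R.
    rewrite /k; case: eqP => // _.
    by rewrite natrB// mulrBl divff ?gt_eqF// natr_sum mulr_suml.
  have ksum : (\sum_(i < m) k i)%N = n.
    rewrite (bigD1 i0)//= {1}/k eqxx -[RHS](subnK sum_le); congr addn.
    by apply: eq_bigr => i /negbTE ii0; rewrite /k ii0.
  split; last by exists k => // i; rewrite mxE.
  split=> [i|]; first by rewrite mxE kE divr_ge0.
  rewrite (eq_bigr (fun i => (k i)%:R / n%:R)); last by move=> i _; rewrite mxE.
  by rewrite -mulr_suml -natr_sum ksum divff ?gt_eqF.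
- move=> i; under eq_cvg do rewrite mxE.
  case: eqP => [->|_]; last exact: r_cvg.
  rewrite -[q 0 i0](addrK (\sum_(j < m | j != i0) q 0 j)).
  rewrite -(bigD1 i0 (P := predT))//= q1.
  by apply: cvgB; [exact: cvg_cst | exact: cvg_sum_ord].
Unshelve. all: by end_near. Qed.

End Types.

(** * Posterior probabilities as quotients of likelihood masses *)
Section Mass.
Variables (R : realType) (m : nat).
Implicit Types (p q : 'rV[R]_m) (nu : nat -> 'rV[R]_m) (A Q : set 'rV[R]_m).

(** The probability of a single sequence of type [w] under the source [q]: the
likelihood without its multinomial coefficient. *)
Definition letter_lik n (w : 'rV[R]_m) q : R :=
  \prod_(i < m) q 0 i ^+ type_count n w i.

Definition mass n (w : 'rV[R]_m) A : R :=
  \sum_(q \in A `&` rational_pmfs R m n) letter_lik n w q.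

Lemma letter_lik_ge0 n w q : pmfs R m q -> 0 <= letter_lik n w q.
Proof. by move=> [q0 _]; apply: prodr_ge0 => i _; exact: exprn_ge0. Qed.

Lemma posterior_probE n p w A : pmfs R m p ->
  posterior_prob n (uniform_prior R m n) w A = mass n w A / mass n w (pmfs R m).
Proof.
move=> pP; have m0 := pmf_dim_gt0 pP.
pose c : R := multinomial_coef n w * ('C(n + m - 1, m - 1))%:R^-1.
have c0 : c != 0.
  apply: mulf_neq0; last first.
    by rewrite invr_neq0// pnatr_eq0 -lt0n bin_gt0 leq_sub2r// leq_addl.
  apply: mulf_neq0; first by rewrite pnatr_eq0 -lt0n fact_gt0.
  rewrite invr_neq0//; apply/prodf_neq0 => i _.
  by rewrite pnatr_eq0 -lt0n fact_gt0.
have likE q : likelihood n w q * uniform_prior R m n q = c * letter_lik n w q.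
  by rewrite /likelihood /uniform_prior mulrAC.
have allE : pmfs R m `&` rational_pmfs R m n = rational_pmfs R m n.
  by apply/setIidPr => q [].
rewrite /posterior_prob /posterior /mass allE mulr_fsuml.
apply: eq_fsbigr => q _.
rewrite likE (eq_fsbigr (fun q' => c * letter_lik n w q'))//.
by rewrite -mulr_fsumr invfM mulrACA divff ?mul1r.
Qed.

Lemma letter_lik_expR n w q : (0 < n)%N -> rational_pmfs R m n w ->
  (forall i, 0 < q 0 i) -> letter_lik n w q = expR (n%:R * Ldivr q w).
Proof.
move=> n0 wn q0; rewrite /Ldivr mulr_sumr expR_sum; apply: eq_bigr => i _.
by rewrite mulrA -type_countE// expRM_natl lnK ?posrE.
Qed.

(** The first alternative is the case L(q || p) = -oo: some letter of the
support of [p], hence of [w], has probability 0 under [q]. Otherwise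
w_i log q_i <= (1 - d) p_i log q_i for each letter, because log q_i <= 0. *)
Lemma letter_lik_le n w p q (d : R) : (0 < n)%N -> rational_pmfs R m n w ->
  pmfs R m p -> pmfs R m q -> d <= 1 ->
  (forall i, p 0 i != 0 -> 0 < w 0 i /\ (1 - d) * p 0 i <= w 0 i) ->
  letter_lik n w q = 0 \/
  (-oo < Ldiv q p)%E /\
  letter_lik n w q <= expR (n%:R * ((1 - d) * fine (Ldiv q p))).
Proof.
move=> n0 wn pP qP d1 pw; have [q0 _] := qP.
have [/forallP q_gt0|] := boolP [forall i, (p 0 i != 0) ==> (0 < q 0 i)].
- have {}q_gt0 i : p 0 i != 0 -> 0 < q 0 i by exact/implyP.
  right; rewrite LdivE//=; split; first exact: ltNyr.
  rewrite /Ldivr !mulr_sumr expR_sum; apply: ler_prod => i _.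
  rewrite exprn_ge0//=.
  have [->|pi0] := eqVneq (p 0 i) 0.
    by rewrite mul0r !mulr0 expR0 exprn_ile1// pmf_le1.
  have [_ le_w] := pw i pi0.
  rewrite -{1}[q 0 i]lnK ?posrE ?q_gt0// -expRM_natl ler_expR type_countE//.
  rewrite -mulrA ler_wpM2l// mulrA ler_wnM2r//.
  exact/ln_le0/pmf_le1.
- rewrite negb_forall => /existsP[i]; rewrite negb_imply -leNgt.
  move=> /andP[pi0 qi].
  left; have qi0 : q 0 i = 0 by apply/eqP; rewrite eq_le qi q0.
  have [wi0 _] := pw i pi0.
  rewrite /letter_lik (bigD1 i)//= qi0 expr0n -(eqr_nat R) type_countE//.
  by rewrite mulf_eq0 pnatr_eq0 (gtn_eqF n0) gt_eqF// mul0r.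
Qed.

(** * Perturbing a source towards the uniform one *)
Definition mix (t : R) q : 'rV[R]_m := \row_i ((1 - t) * q 0 i + t * m%:R^-1).

Lemma mix_cvg q i : mix t q 0 i @[t --> 0^'+] --> q 0 i.
Proof.
under eq_cvg do rewrite mxE; apply: cvg_at_right_filter.
have {2}<- : (1 - 0) * q 0 i + 0 * m%:R^-1 = q 0 i.
  by rewrite subr0 mul1r mul0r addr0.
apply: cvgD; apply: cvgMl; last exact: cvg_id.
by apply: cvgB; [exact: cvg_cst|exact: cvg_id].
Qed.

Lemma mix_pmf t q : 0 < t < 1 -> pmfs R m q ->
  pmfs R m (mix t q) /\ forall i, 0 < mix t q 0 i.
Proof.
move=> /andP[t0 t1] qP; have [q0 q1] := qP; have m0 := pmf_dim_gt0 qP.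
have mix_gt0 i : 0 < mix t q 0 i.
  rewrite mxE; apply: ltr_wpDl; first by rewrite mulr_ge0// subr_ge0 ltW.
  by rewrite mulr_gt0// invr_gt0 ltr0n.
split=> //; split=> [i|]; first exact: ltW.
under eq_bigr do rewrite mxE.
rewrite big_split/= -mulr_sumr q1 sumr_const card_ord.
rewrite -[X in _ + X]mulr_natr -mulrA.
by rewrite mulVf ?pnatr_eq0 -?lt0n// !mulr1 subrK.
Qed.

Lemma mix_near Q q : open_sources Q -> Q q ->
  \forall t \near 0^'+, Q (mix t q) /\ forall i, 0 < mix t q 0 i.
Proof.
move=> [U Uo QE]; rewrite {1}QE => -[qP Uq].
have U_near : \forall t \near 0^'+, U (mix t q).
  have mixq : mix t q @[t --> 0^'+] --> q by exact/cvg_row_coord/mix_cvg.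
  by apply: mixq; exact: open_nbhs_nbhs.
near=> t.
have [mixP mix0] : pmfs R m (mix t q) /\ forall i, 0 < mix t q 0 i.
  apply: mix_pmf => //; apply/andP; split; near: t.
    exact: nbhs_right_gt.
  exact: nbhs_right_lt.
by split=> //; rewrite QE; split=> //; near: t.
Unshelve. all: by end_near. Qed.

(** [Ldivr] is continuous along the segment from [q] to the uniform source:
letters with p_i = 0 contribute nothing, and q_i > 0 for the others because
L(q || p) is finite. *)
Lemma positive_source Q p q (a : R) : open_sources Q -> pmfs R m p -> Q q ->
  (a%:E < Ldiv q p)%E ->
  exists q', [/\ Q q', forall i, 0 < q' 0 i & a < Ldivr q' p].
Proof.
move=> Qo pP Qq aq.
have q0 : forall i, p 0 i != 0 -> 0 < q 0 i.
  by apply: Ldiv_gtNy_gt0 => //; apply: lt_trans aq; exact: ltNyr.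
have Ldivr_cvg : Ldivr (mix t q) p @[t --> 0^'+] --> Ldivr q p.
  apply: cvg_sum_ord => i; have [->|pi0] := eqVneq (p 0 i) 0.
    by under eq_cvg do rewrite mul0r; rewrite mul0r; exact: cvg_cst.
  apply: cvgMr; apply: continuous_cvg; last exact: mix_cvg.
  exact/continuous_ln/q0.
rewrite LdivE// lte_fin in aq.
have [t [[Qt t0] at_]] :=
  @filter_ex _ 0^'+ _ _ (filterI (mix_near Qo Qq) (cvgr_gt _ Ldivr_cvg _ aq)).
by exists (mix t q).
Qed.

(** * Exponential rate of the likelihood mass *)
Section Asymptotics.
Variables (p : 'rV[R]_m) (nu : nat -> 'rV[R]_m).
Hypothesis pP : pmfs R m p.
Hypothesis nuP : forall n, (0 < n)%N -> rational_pmfs R m n (nu n).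
Hypothesis nu_cvg : forall i, nu n 0 i @[n --> \oo] --> p 0 i.

Lemma mass_ge Q q (a : R) : open_sources Q -> Q q -> (a%:E < Ldiv q p)%E ->
  \forall n \near \oo, expR (n%:R * a) <= mass n (nu n) Q.
Proof.
move=> Qo Qq0 aq0; have [q' [Qq q0 aq]] := positive_source Qo pP Qq0 aq0.
have [U Uo QE] := Qo.
have [qP Uq] : pmfs R m q' /\ U q' by move: Qq; rewrite QE.
have [qn qnP qn_cvg] := rational_pmfs_dense qP.
have Ldivr_cvg : Ldivr (qn n) (nu n) @[n --> \oo] --> Ldivr q' p.
  apply: cvg_sum_ord => i; apply: cvgM => //.
  by apply: continuous_cvg => //; exact: continuous_ln.
near=> n.
have n0 : (0 < n)%N by near: n; exact: nbhs_infty_gt.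
have Qqn : Q (qn n).
  rewrite QE; split; first by case: (qnP n n0).
  near: n; have qnq : qn n @[n --> \oo] --> q' by exact: cvg_row_coord.
  by apply: qnq; exact: open_nbhs_nbhs.
have qn0 : forall i, 0 < qn n 0 i.
  near: n; apply: filter_forall => i; exact: (cvgr_gt _ (@qn_cvg i)).
apply: le_trans (fsum_rational_ge _ Qqn (qnP n n0)); last first.
  by move=> q'' [q''P _]; exact: letter_lik_ge0.
rewrite (letter_lik_expR n0 (nuP n0) qn0) ler_expR ler_wpM2l//.
by apply: ltW; near: n; exact: cvgr_gt Ldivr_cvg _ aq.
Unshelve. all: by end_near. Qed.

(** Half of the gap [b - l] absorbs the factor [1 - d] on [l], the other half
the number of n-types. *)
Lemma mass_le Q (l b : R) : Q `<=` pmfs R m ->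
  (forall q, Q q -> (Ldiv q p <= l%:E)%E) -> l < b ->
  \forall n \near \oo, mass n (nu n) Q <= expR (n%:R * b).
Proof.
move=> QP Ql lb; pose e := (b - l) / 2.
have e0 : 0 < e by rewrite /e; lra.
(* [D] makes both [d <= 1] and [d * `|l| <= e]. *)
pose D := 1 + `|l| + e; pose d := e / D.
have D0 : 0 < D by rewrite /D; have := normr_ge0 l; lra.
have d0 : 0 < d by rewrite divr_gt0.
have d1 : d <= 1.
  by rewrite ler_pdivrMr// mul1r /D; have := normr_ge0 l; lra.
have dl : (1 - d) * l <= l + e.
  have : d * `|l| <= e.
    by rewrite mulrAC ler_pdivrMr// ler_pM2l// /D; lra.
  have : - (d * l) <= d * `|l|.
    by rewrite -mulrN ler_wpM2l ?(ltW d0)// -normrN ler_norm.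
  lra.
near=> n.
have n0 : (0 < n)%N by near: n; exact: nbhs_infty_gt.
have near_p i : p 0 i != 0 -> 0 < nu n 0 i /\ (1 - d) * p 0 i <= nu n 0 i.
  move: i; near: n; apply: filter_forall => i.
  have [->|pi0] := eqVneq (p 0 i) 0; first exact: nearW.
  have {}pi0 : 0 < p 0 i by rewrite lt_neqAle eq_sym pi0; case: pP => ->.
  have dp : (1 - d) * p 0 i < p 0 i by rewrite gtr_pMl//; lra.
  have w_gt0 : \forall n \near \oo, 0 < nu n 0 i.
    exact: cvgr_gt (@nu_cvg i) _ pi0.
  have w_gt : \forall n \near \oo, (1 - d) * p 0 i < nu n 0 i.
    exact: cvgr_gt (@nu_cvg i) _ dp.
  by near=> n => _; split; [|apply: ltW]; near: n.
apply: (@le_trans _ _ ((n.+1 ^ m)%:R * expR (n%:R * (l + e)))).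
  apply: fsum_rational_le; first exact: expR_ge0.
  move=> q Qq _.
  have [->|[qNy]] := letter_lik_le n0 (nuP n0) pP (QP _ Qq) d1 near_p.
    exact: expR_ge0.
  move=> /le_trans; apply; rewrite ler_expR ler_wpM2l//.
  apply: (le_trans _ dl); rewrite ler_wpM2l ?subr_ge0//.
  by have := Ql _ Qq; move: qNy; case: (Ldiv q p).
have -> : b = e + (l + e) by rewrite /e; lra.
rewrite [_ * (e + _)]mulrDr expRD ler_wpM2r ?expR_ge0//.
by near: n; exact: poly_le_exp.
Unshelve. all: by end_near. Qed.

Lemma Ldiv_le0 q : pmfs R m q -> (Ldiv q p <= 0)%E.
Proof.
move=> qP; apply: sume_le0 => i _; apply: mule_ge0_le0.
  by rewrite lee_fin; case: pP.
by rewrite lne_le0 lee_fin pmf_le1.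
Qed.

(** The value is at most 0, and it is not -oo because an open set of sources
contains a source with full support. *)
Lemma Ldiv_set_fin_num Q : open_sources Q -> Q !=set0 ->
  Ldiv_set Q p \is a fin_num.
Proof.
move=> Qo [q Qq]; have QP : Q `<=` pmfs R m by case: Qo => U _ -> q' [].
have [t [Qt t0]] := @filter_ex _ 0^'+ _ _ (mix_near Qo Qq).
rewrite fin_numElt; apply/andP; split.
  apply: (@lt_le_trans _ _ (Ldiv (mix t q) p)).
    by rewrite LdivE ?ltNyr.
  by apply: ereal_sup_ubound; exists (mix t q).
apply: (@le_lt_trans _ _ 0%E); last exact: ltry.
by apply: ge_ereal_sup => _ [q' Qq' <-]; exact/Ldiv_le0/QP.
Qed.

Lemma mass_ge_near Q (l a : R) : open_sources Q -> Ldiv_set Q p = l%:E ->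
  a < l -> \forall n \near \oo, expR (n%:R * a) <= mass n (nu n) Q.
Proof.
rewrite -lte_fin => Qo <- /ereal_sup_gt[_ [q Qq <-]]; exact: mass_ge.
Qed.

Lemma mass_gt0 Q : open_sources Q -> Q !=set0 ->
  \forall n \near \oo, 0 < mass n (nu n) Q.
Proof.
move=> Qo Q0; have /fineK/esym lE := Ldiv_set_fin_num Qo Q0.
have l1 : fine (Ldiv_set Q p) - 1 < fine (Ldiv_set Q p) by lra.
apply: filterS (mass_ge_near Qo lE l1) => n.
by apply: lt_le_trans; rewrite expR_gt0.
Qed.

Lemma mass_cvg Q : open_sources Q ->
  ((n%:R^-1 : R)%:E * lne (mass n (nu n) Q)%:E)%E @[n --> \oo] --> Ldiv_set Q p.
Proof.
move=> Qo; have [->|/set0P Q0] := eqVneq Q set0.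
  rewrite /Ldiv_set image_set0 ereal_sup0.
  have : (fun=> -oo%E : \bar R) @ \oo --> (-oo%E : \bar R) by exact: cvg_cst.
  apply: cvg_trans; apply: near_eq_cvg; near=> n.
  have n0 : (0 < n)%N by near: n; exact: nbhs_infty_gt.
  rewrite /mass set0I fsbig_set0 /= lexx gt0_muleNy//.
  by rewrite lte_fin invr_gt0 ltr0n.
have /fineK/esym lE := Ldiv_set_fin_num Qo Q0; set l := fine _ in lE.
have QP : Q `<=` pmfs R m by case: Qo => U _ -> q' [].
have Ql q : Q q -> (Ldiv q p <= l%:E)%E.
  by move=> Qq; rewrite -lE; apply: ereal_sup_ubound; exists q.
rewrite lE.
have : (n%:R^-1 * ln (mass n (nu n) Q))%:E @[n --> \oo] --> l%:E.
  apply: cvg_EFin; first exact: nearW.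
  apply/cvgrPdist_le => e e0; near=> n => /=.
  have n0 : (0 : R) < n%:R.
    by rewrite ltr0n; near: n; exact: nbhs_infty_gt.
  have M0 : 0 < mass n (nu n) Q by near: n; exact: mass_gt0.
  rewrite mulrC distrC ler_distl ler_pdivlMr// ler_pdivrMr//.
  rewrite -ler_expR -[X in _ && X]ler_expR lnK ?posrE//.
  rewrite ![_ * n%:R]mulrC; apply/andP; split; near: n.
    by apply: (mass_ge_near Qo lE); lra.
  by apply: (mass_le QP Ql); lra.
apply: cvg_trans; apply: near_eq_cvg.
by apply: filterS (mass_gt0 Qo Q0) => n M0; rewrite lne_EFin.
Unshelve. all: by end_near. Qed.

End Asymptotics.
End Mass.

Theorem mainTheorem5 (R : realType) (m : nat) (p : 'rV[R]_m)
    (nu : nat -> 'rV[R]_m) (Q : set 'rV[R]_m)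
    (p_pmf : pmfs R m p)
    (nu_type : forall n : nat, (0 < n)%N -> rational_pmfs R m n (nu n))
    (nu_cvg : (fun n : nat => tv_dist (nu n) p) @ \oo --> (0 : R))
    (Q_open : open_sources Q) :
  (fun n : nat =>
     ((n%:R^-1 : R)%:E *
      lne (posterior_prob n (uniform_prior R m n) (nu n) Q)%:E)%E) @ \oo
  --> (Ldiv_set Q p - Ldiv_set (pmfs R m) p)%E.
Proof.
have nu_p i : nu n 0 i @[n --> \oo] --> p 0 i by exact: tv_cvg_coord.
have P_open : open_sources (pmfs R m).
  by exists setT; [exact: openT | rewrite setIT].
have P_nonempty : pmfs R m !=set0 by exists p.
have Q_lim := mass_cvg p_pmf nu_type nu_p Q_open.
have P_lim := mass_cvg p_pmf nu_type nu_p P_open.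
have P_fin := Ldiv_set_fin_num p_pmf P_open P_nonempty.
have def_diff : (Ldiv_set Q p +? - Ldiv_set (pmfs R m) p)%E.
  by apply: fin_num_adde_defl; rewrite fin_numN.
have : ((n%:R^-1 : R)%:E * lne (mass n (nu n) Q)%:E -
    (n%:R^-1 : R)%:E * lne (mass n (nu n) (pmfs R m))%:E)%E @[n --> \oo] -->
    (Ldiv_set Q p - Ldiv_set (pmfs R m) p)%E by exact: cvgeB.
apply: cvg_trans; apply: near_eq_cvg.
apply: filterS (mass_gt0 p_pmf nu_type nu_p P_open P_nonempty) => n P0.
(* [P_lne] makes the subtraction meaningful also when the mass of [Q] is 0. *)
have P_lne : lne (mass n (nu n) (pmfs R m))%:E \is a fin_num.
  by rewrite lne_EFin.
rewrite (posterior_probE _ _ _ p_pmf) -muleBr//; last first.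
  by apply: fin_num_adde_defl; rewrite fin_numN.
congr (_ * _)%E.
have [M0|M0] := leP (mass n (nu n) Q) 0.
  have quot_le0 : mass n (nu n) Q / mass n (nu n) (pmfs R m) <= 0.
    by rewrite pmulr_lle0 ?invr_gt0.
  by rewrite (@le0_lneNy _ (mass n (nu n) Q)%:E)//
    (@le0_lneNy _ (_ / _)%:E)// addNye.
by rewrite !lne_EFin ?divr_gt0// ln_div ?posrE.
Qed.
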